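(* Let $\Phi:[0,1]\to\mathbb R$ be continuous on $[0,1]$ and differentiable on $(0,1)$ with $\Phi'$ increasing, continuous and strictly concave on $(0,1)$. Then for $n\ge1$, $a,\rho\in(0,1)$ with $2^na\in\mathbb Z$, $$\mathbf{MaxStab}_\Phi(a)\le\Lambda_\rho(a)=\widetilde\Gamma_\rho(a):=\sup_{0\le z_2\le1-a}(1-a-p)\Phi(0)+p\Phi(a+\rho z_1)+a\Phi(a+\rho z_2),$$ where $z_1=\frac{z_2(\rho(1-z_2)-a)}{1-a-\rho z_2}$ and $p=\frac{a(1-a-\rho z_2)^2}{a+\rho^2z_2-(a+\rho z_2)^2}$.
   Context: $\mathbf X$ uniform on $\{-1,1\}^n$; $\mathbf Y$ obtained by independently flipping each coordinate of $\mathbf X$ with probability $(1-\rho)/2$; $T_\rho f(\mathbf x)=\mathbb E[f(\mathbf Y)\mid\mathbf X=\mathbf x]$; $\mathbf{MaxStab}_\Phi(a)=\max\{\mathbb E[\Phi(T_\rho f(\mathbf X))]:f:\{-1,1\}^n\to\{0,1\},\mathbb Ef(\mathbf X)=a\}$. $\Lambda_\rho(a)$ is the common value for $m\ge3$ of $\max\sum_{(s,i)\in\mathcal S\times[m]}p_{s,i}\Phi(a+\rho z_{s,i})$ over $z_{s,i}\in\mathbb R$, $p_{s,i}>0$ subject to $0\le a+\rho z_{s,i}\le1$, $\sum_ip_{s,i}=P_S(s)$ for $s\in\mathcal S$, $\sum_{s,i}p_{s,i}z_{s,i}=0$, $\sum_{s,i}p_{s,i}(z_{s,i}^2-sz_{s,i})\le0$,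 where $\mathcal S=\{-a,1-a\}$, $P_S(-a)=1-a$, $P_S(1-a)=a$. *)

(* Defs.v *)
From HB Require Import structures.
From mathcomp Require Import all_boot all_order all_algebra.
From mathcomp Require Import all_classical all_reals all_analysis.
Set Implicit Arguments. Unset Strict Implicit. Unset Printing Implicit Defensive.
Import Order.TTheory GRing.Theory Num.Theory numFieldNormedType.Exports.
Local Open Scope ring_scope.
Local Open Scope classical_set_scope.

Section Defs.
Variable R : realType.

(* {-1,1}^n encoded as 'I_n -> bool (true <-> 1, false <-> -1). *)
Definition cube (n : nat) := {ffun 'I_n -> bool}.

(* P(Y = y | X = x): each coordinate flipped independently w.p. (1-rho)/2. *)
Definition trans (rho : R) (n : nat) (x y : cube n) : R :=
  \prod_(i < n) (if x i == y i then (1 + rho) / 2 else (1 - rho) / 2).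

Definition Trho (rho : R) (n : nat) (f : cube n -> bool) (x : cube n) : R :=
  \sum_(y : cube n) trans rho x y * (f y)%:R.

Definition Eunif (n : nat) (g : cube n -> R) : R :=
  ((2 : R) ^+ n)^-1 * \sum_(x : cube n) g x.

(* MaxStab_Phi(a) (on {-1,1}^n, noise rho): max (= sup of a finite set). *)
Definition MaxStab (Phi : R -> R) (rho : R) (n : nat) (a : R) : R :=
  sup [set v | exists f : cube n -> bool,
        Eunif (fun x => (f x)%:R) = a /\
        v = Eunif (fun x => Phi (Trho rho f x))].

(* S = {-a, 1-a}, indexed by bool: true <-> 1-a, false <-> -a. *)
Definition sval (a : R) (b : bool) : R := if b then 1 - a else - a.
Definition PS (a : R) (b : bool) : R := if b then a else 1 - a.

Definition LambdaM (Phi : R -> R) (rho a : R) (m : nat) : R :=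
  sup [set v | exists (z p : bool -> 'I_m -> R),
        [/\ (forall b i, 0 < p b i),
            (forall b i, 0 <= a + rho * z b i <= 1),
            (forall b, \sum_(i < m) p b i = PS a b),
            (\sum_(b : bool) \sum_(i < m) p b i * z b i = 0) /\
            (\sum_(b : bool) \sum_(i < m) p b i * (z b i ^+ 2 - sval a b * z b i) <= 0)
          & v = \sum_(b : bool) \sum_(i < m) p b i * Phi (a + rho * z b i)]].

Definition z1_of (rho a z2 : R) : R :=
  z2 * (rho * (1 - z2) - a) / (1 - a - rho * z2).
Definition p_of (rho a z2 : R) : R :=
  a * (1 - a - rho * z2) ^+ 2 / (a + rho ^+ 2 * z2 - (a + rho * z2) ^+ 2).

Definition GammaT (Phi : R -> R) (rho a : R) : R :=
  sup [set v | exists z2 : R, 0 <= z2 <= 1 - a /\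
        v = (1 - a - p_of rho a z2) * Phi 0
            + p_of rho a z2 * Phi (a + rho * z1_of rho a z2)
            + a * Phi (a + rho * z2)].

End Defs.

(* Main.v *)
Require Import Defs.
From HB Require Import structures.
From mathcomp Require Import all_boot all_order all_algebra.
From mathcomp Require Import all_classical all_reals all_analysis.
From mathcomp Require Import ring lra.
Import Order.TTheory GRing.Theory Num.Theory numFieldNormedType.Exports.
Set Implicit Arguments. Unset Strict Implicit. Unset Printing Implicit Defensive.
Local Open Scope ring_scope.
Local Open Scope classical_set_scope.

(** Write [x = a + rho z], and let [b] be the bit attached to [s].  A feasible
    law is a law of [(b, x)] on [bool * [0, 1]] with [P(b = 1) = a], [E x = a]
    and [E (x^2 - rho b x) <= a^2 (1 - rho)].  Both [(f(X), T_rho f(X))] (in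
    Fourier space the second moment bound reads [rho^(2k) <= rho^(k+1)] for
    [k >= 1]) and the three-point laws parametrised by [z2], with atoms [0] and
    [x1] for [b = 0] and [x2] for [b = 1], are feasible.

    Optimality is proved by linear programming duality: it suffices to find
    parabolas [al_b + la x + mu (x^2 - rho b x)], [mu >= 0], that dominate
    [Phi] on [[0, 1]] for [b = 0, 1] and touch it at the atoms of some
    three-point law.  Since [Phi'] is strictly concave, [Phi] minus a parabola
    has a derivative with sign pattern [-, +, -], so tangency at [x1] together
    with contact at [0] already gives domination for [b = 0], and tangency at
    [x2 > x1] then gives it for [b = 1].  The remaining compatibility condition
    between [x1] and [x2] is one equation in [z2], solved by the intermediate
    value theorem, or else replaced by a degenerate case at [z2 = 1 - a]. *)

(** * Maxima of functions whose derivative is strictly concave *)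

Definition strictly_concave01 (R : realType) (k : R -> R) : Prop :=
  forall x y z, 0 < x -> x < y -> y < z -> z < 1 ->
    (z - y) * k x + (y - x) * k z < (z - x) * k y.

(** No slope is asked for at [0] and [1], where [Phi] may not have one; continuity from within
    suffices for the mean value theorem. *)
Definition primitive01 (R : realType) (h k : R -> R) : Prop :=
  {within [set x : R | 0 <= x <= 1], continuous h} /\
  forall x : R, 0 < x < 1 -> is_derive x 1 h (k x).

Lemma primitive01_mvt (R : realType) (h k : R -> R) (u v : R) :
  primitive01 h k -> 0 <= u -> u < v -> v <= 1 ->
  exists2 c, u < c < v & h v - h u = k c * (v - u).
Proof.
move=> [hc hd] u0 uv v1.
have [||c cuv e] := @MVT R h k u v uv.
- move=> x; rewrite in_itv/= => /andP[ux xv]; apply: hd.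
  by rewrite (le_lt_trans u0 ux) (lt_le_trans xv v1).
- apply: continuous_subspaceW hc => x /=; rewrite in_itv/= => /andP[ux xv].
  by rewrite (le_trans u0 ux) (le_trans xv v1).
- by exists c => //; move: cuv; rewrite in_itv.
Qed.

Lemma primitive01_addquad (R : realType) (h k : R -> R) (l m : R) :
  primitive01 h k ->
  primitive01 (fun x => h x - l * x - m * x ^+ 2)
                (fun x => k x - l - 2 * m * x).
Proof.
move=> [hc hd]; split.
  have qc : {within [set x : R | 0 <= x <= 1],
      continuous (fun x : R => l * x + m * x ^+ 2)}.
    apply: continuous_subspaceT => y.
    apply: cvgD; apply: cvgM; [exact: cvg_cst|exact: cvg_id|exact: cvg_cst|].
    exact: exprn_continuous.
  have -> : (fun x => h x - l * x - m * x ^+ 2) =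
            (fun x => h x - (l * x + m * x ^+ 2)).
    by apply/funext => x; ring.
  by move=> x; apply: cvgB; [exact: hc|exact: qc].
move=> x /hd hx.
apply: is_derive_eq.
rewrite /GRing.scale /=; ring.
Qed.

Lemma strictly_concave01_addlin (R : realType) (k : R -> R) (l m : R) :
  strictly_concave01 k -> strictly_concave01 (fun x => k x - l - 2 * m * x).
Proof. by move=> kc x y z x0 xy yz z1; have := kc x y z x0 xy yz z1; lra. Qed.

(** A larger value at [x < x1] yields [c < d < x1] with [k c > 0 > k d] and [k x1 = 0]. One at
    [x > x1] yields zeros of [k] at some [c < x1] and at [x1], followed by a positive value.
    Concavity excludes both. *)
Lemma le_max_at_0_and_zero (R : realType) (h k : R -> R) (x1 x : R) :
  primitive01 h k -> strictly_concave01 k ->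
  0 < x1 < 1 -> h 0 = h x1 -> k x1 = 0 -> 0 <= x <= 1 -> h x <= h x1.
Proof.
move=> hk kc /andP[x10 x11] h0 k1 /andP[x0 xle1].
rewrite leNgt; apply/negP => hx.
have {}x0 : 0 < x.
  by rewrite lt_def x0 andbT; apply/eqP => xe; rewrite xe h0 ltxx in hx.
have [xx1|xx1|xx1] := ltgtP x x1; last by rewrite xx1 ltxx in hx.
- have [c /andP[c0 cx] e] := primitive01_mvt hk (lexx _) x0 xle1.
  have [d /andP[xd dx] e'] :=
    primitive01_mvt hk (ltW x0) xx1 (ltW x11).
  have := kc c d x1 c0 (lt_trans cx xd) dx x11.
  have : 0 < k c * x by lra.
  rewrite pmulr_lgt0// => kc0.
  have : k d * (x1 - x) < 0 by lra.
  rewrite pmulr_llt0 ?subr_gt0// => kd0.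
  nra.
- have [c /andP[c0 cx] e] :=
    primitive01_mvt hk (lexx _) x10 (ltW x11).
  have [d /andP[xd dx] e'] := primitive01_mvt hk (ltW x10) xx1 xle1.
  have := kc c x1 d c0 cx xd (lt_le_trans dx xle1).
  have : k c * x1 = 0 by lra.
  move=> /eqP; rewrite mulf_eq0 (gt_eqF x10) orbF => /eqP kc0.
  have : 0 < k d * (x - x1) by lra.
  rewrite pmulr_lgt0 ?subr_gt0// => kd0.
  rewrite kc0 k1; nra.
Qed.

(** By concavity [k] is positive between [x1] and [x2] and negative past [x2], so [h] rises up to
    [x2] and then falls. *)
Lemma le_max_at_upper_zero (R : realType) (h k : R -> R) (x1 x2 x : R) :
  primitive01 h k -> strictly_concave01 k ->
  0 < x1 -> x1 < x2 -> x2 < 1 -> 0 < k x1 -> k x2 = 0 ->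
  x1 <= x <= 1 -> h x <= h x2.
Proof.
move=> hk kc x10 x12 x21 k1 k2 /andP[x1x xle1].
rewrite leNgt; apply/negP => hx.
have x0 := lt_le_trans x10 x1x.
have [xx2|xx2|xx2] := ltgtP x x2; last by rewrite xx2 ltxx in hx.
- have [c /andP[cx cx2] e] :=
    primitive01_mvt hk (ltW x0) xx2 (ltW x21).
  have := kc x1 c x2 x10 (le_lt_trans x1x cx) cx2 x21.
  have : k c * (x2 - x) < 0 by lra.
  rewrite pmulr_llt0 ?subr_gt0// => kc0.
  rewrite k2; nra.
- have [c /andP[x2c cx] e] :=
    primitive01_mvt hk (ltW (lt_trans x10 x12)) xx2 xle1.
  have := kc x1 x2 c x10 x12 x2c (lt_le_trans cx xle1).
  have : 0 < k c * (x - x2) by lra.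
  rewrite pmulr_lgt0 ?subr_gt0// => kc0.
  rewrite k2; nra.
Qed.

(** * Moments of the three-point laws *)

Section ThreePointLaw.
Variables (R : realType) (a rho z2 : R).
Hypotheses (a01 : 0 < a < 1) (rho01 : 0 < rho < 1) (z2_ge0 : 0 <= z2)
  (z2_le : z2 <= 1 - a).

Let x1 := a + rho * z1_of rho a z2.
Let x2 := a + rho * z2.
Let p := p_of rho a z2.

Lemma x2_lt1 : x2 < 1.
Proof.
have /andP[a0 a1] := a01; have /andP[r0 r1] := rho01.
have := ler_wpM2l (ltW r0) z2_le; rewrite /x2.
have : 0 < (1 - rho) * (1 - a) by rewrite mulr_gt0 ?subr_gt0.
nra.
Qed.

Lemma p_of_den_gt0 : 0 < a + rho ^+ 2 * z2 - (a + rho * z2) ^+ 2.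
Proof.
have /andP[a0 a1] := a01; have /andP[r0 r1] := rho01.
(* Each summand is nonnegative; the second is positive when [z2 > 0], the first when [z2 = 0]. *)
have -> : a + rho ^+ 2 * z2 - (a + rho * z2) ^+ 2 =
  a * (1 - a - z2) + a * z2 * (1 - rho) ^+ 2 + rho ^+ 2 * z2 * (1 - a - z2).
  by ring.
have [->|z20] := eqVneq z2 0; first nra.
have {}z20 : 0 < z2 by rewrite lt_def z20.
have : 0 < a * z2 * (1 - rho) ^+ 2.
  by rewrite !mulr_gt0 ?subr_gt0.
have : 0 <= a * (1 - a - z2) by rewrite mulr_ge0 ?subr_ge0// ltW.
have : 0 <= rho ^+ 2 * z2 * (1 - a - z2).
  by rewrite !mulr_ge0 ?subr_ge0// ?ltW.
lra.
Qed.

Let den_neq0 : a + rho ^+ 2 * z2 - (a + rho * z2) ^+ 2 != 0.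
Proof. by rewrite gt_eqF ?p_of_den_gt0. Qed.

Let top_gt0 : 0 < 1 - a - rho * z2.
Proof. by have := x2_lt1; rewrite /x2; lra. Qed.

Let top_neq0 : 1 - a - rho * z2 != 0.
Proof. by rewrite gt_eqF. Qed.

(** The numerator is the denominator of [p_of], so [p * x1 = a * (1 - x2)]; this makes the two
    moment identities below cancel. *)
Lemma x1_fracE :
  x1 = (a + rho ^+ 2 * z2 - (a + rho * z2) ^+ 2) / (1 - a - rho * z2).
Proof. by rewrite /x1 /z1_of; field. Qed.

Lemma x1_gt0 : 0 < x1.
Proof. by rewrite x1_fracE divr_gt0 ?p_of_den_gt0. Qed.

Lemma x1_le_x2 : x1 <= x2.
Proof.
have /andP[a0 a1] := a01; have /andP[r0 r1] := rho01.
rewrite x1_fracE ler_pdivrMr// /x2.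
have : 0 <= rho * z2 * (1 - rho) by rewrite !mulr_ge0 ?subr_ge0// ltW.
nra.
Qed.

Lemma x1_lt1 : x1 < 1. Proof. exact: le_lt_trans x1_le_x2 x2_lt1. Qed.

Lemma p_of_gt0 : 0 < p.
Proof.
have /andP[a0 a1] := a01.
by rewrite /p /p_of divr_gt0 ?p_of_den_gt0// !mulr_gt0.
Qed.

(** The mass left for the atom at [0] is [1 - a - p]. Multiplied by the denominator of [p] it is
    [rho ^+ 2 * z2 * (1 - a - z2)], which vanishes exactly at the two ends of the range of [z2]. *)
Lemma p_of_le : p <= 1 - a.
Proof.
have /andP[r0 r1] := rho01.
rewrite /p /p_of ler_pdivrMr ?p_of_den_gt0//.
have : 0 <= rho ^+ 2 * z2 * (1 - a - z2).
  by rewrite !mulr_ge0 ?subr_ge0// ?ltW.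
nra.
Qed.

Lemma three_point_mean : p * x1 + a * x2 = a.
Proof. by rewrite x1_fracE /p /p_of /x2; field; rewrite ?den_neq0 ?top_neq0. Qed.

Lemma three_point_second_moment :
  p * x1 ^+ 2 + a * (x2 ^+ 2 - rho * x2) = a ^+ 2 * (1 - rho).
Proof. by rewrite x1_fracE /p /p_of /x2; field; rewrite ?den_neq0 ?top_neq0. Qed.

End ThreePointLaw.

Lemma x1_at_0 (R : realType) (a rho : R) : a + rho * z1_of rho a 0 = a.
Proof. by rewrite /z1_of !mul0r mulr0 addr0. Qed.

(** Here [x2 = a + rho * (1 - a)], so the atoms [x1] and [x2] are exactly [rho] apart. *)
Lemma x1_at_max (R : realType) (a rho : R) : 0 < a < 1 -> 0 < rho < 1 ->
  a + rho * z1_of rho a (1 - a) = a + rho * (1 - a) - rho.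
Proof.
move=> /andP[a0 a1] /andP[r0 r1]; rewrite /z1_of; field.
have -> : 1 - a - rho * (1 - a) = (1 - rho) * (1 - a) by ring.
by rewrite mulf_neq0// gt_eqF// subr_gt0.
Qed.

Lemma p_of_at_max (R : realType) (a rho : R) : 0 < a < 1 -> 0 < rho < 1 ->
  p_of rho a (1 - a) = 1 - a.
Proof.
move=> a01 rho01.
have /andP[a0 a1] := a01.
have d0 := p_of_den_gt0 a01 rho01 (eqbRL (subr_ge0 a 1) (ltW a1)) (lexx _).
by rewrite /p_of; field; rewrite gt_eqF.
Qed.

(** * Fourier analysis of the noise operator on the cube *)

Section NoiseOperator.
Variables (R : realType) (n : nat).

Definition sgn (b : bool) : R := if b then 1 else -1.
Definition chi (S : {set 'I_n}) (x : cube n) : R := \prod_(i in S) sgn (x i).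
Definition fourier (f : cube n -> R) (S : {set 'I_n}) : R :=
  Eunif (fun x => f x * chi S x).

Lemma transC (rho : R) (x y : cube n) : trans rho x y = trans rho y x.
Proof. by apply: eq_bigr => i _; rewrite eq_sym. Qed.

Lemma trans_ge0 (rho : R) (x y : cube n) : 0 < rho < 1 -> 0 <= trans rho x y.
Proof.
move=> /andP[r0 r1]; apply: prodr_ge0 => i _.
by case: ifP => _; lra.
Qed.

Lemma sum_trans (rho : R) (x : cube n) : \sum_y trans rho x y = 1.
Proof.
rewrite /trans.
rewrite -(bigA_distr_bigA (fun (i : 'I_n) (b : bool) =>
  if x i == b then (1 + rho) / 2 else (1 - rho) / 2 : R)).
rewrite big1// => i _; rewrite big_bool /=.
by case: (x i) => /=; field.
Qed.

(** Two noise steps through a common point compose; the sum over the cube factors into one two-term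
    sum per coordinate. *)
Lemma trans_semigroup (rho : R) (x z : cube n) :
  \sum_y trans rho y x * trans rho y z = trans (rho ^+ 2) x z.
Proof.
rewrite /trans; under eq_bigr do rewrite -big_split /=.
rewrite -(bigA_distr_bigA (fun (i : 'I_n) (b : bool) =>
  (if b == x i then (1 + rho) / 2 else (1 - rho) / 2) *
  (if b == z i then (1 + rho) / 2 else (1 - rho) / 2 : R))).
apply: eq_bigr => i _; rewrite big_bool /=.
by case: (x i); case: (z i) => /=; field.
Qed.

(** In signs, each factor is [(1 + rho * x_i * y_i) / 2]; expanding the product gives one Walsh
    character term per subset [S]. *)
Lemma trans_fourier (rho : R) (x y : cube n) :
  trans rho x y = (2 ^+ n)^-1 * \sum_(S : {set 'I_n}) rho ^+ #|S| * (chi S x * chi S y).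
Proof.
have -> : trans rho x y =
    \prod_(i < n) (2^-1 * (rho * (sgn (x i) * sgn (y i)) + 1)).
  by apply: eq_bigr => i _; case: (x i); case: (y i) => /=; field.
rewrite big_split /= prodr_const card_ord exprVn; congr (_ * _).
rewrite bigA_distr; apply: eq_bigr => S _.
by rewrite -big_mkcond /= !big_split /= prodr_const.
Qed.

Lemma Eunif_Trho (rho : R) (f : cube n -> bool) :
  Eunif (Trho rho f) = Eunif (fun x => (f x)%:R).
Proof.
rewrite /Eunif /Trho; congr (_ * _); rewrite exchange_big /=.
apply: eq_bigr => y _; rewrite -mulr_suml.
under eq_bigr do rewrite transC.
by rewrite sum_trans mul1r.
Qed.

Lemma Trho_itv (rho : R) (f : cube n -> bool) (x : cube n) :
  0 < rho < 1 -> 0 <= Trho rho f x <= 1.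
Proof.
move=> rho01; rewrite sumr_ge0 /=; last first.
  by move=> y _; rewrite mulr_ge0 ?trans_ge0.
rewrite -(sum_trans rho x); apply: ler_sum => y _.
by rewrite ler_piMr ?trans_ge0// lern1 leq_b1.
Qed.

Lemma Eunif_mul_Trho (rho : R) (f : cube n -> bool) :
  Eunif (fun x => (f x)%:R * Trho rho f x) =
  \sum_(S : {set 'I_n}) rho ^+ #|S| * fourier (fun x => (f x)%:R) S ^+ 2.
Proof.
pose F (x : cube n) : R := (f x)%:R.
have -> : Eunif (fun x => (f x)%:R * Trho rho f x) = (2 ^+ n)^-1 *
    \sum_x \sum_y \sum_(S : {set 'I_n}) (2 ^+ n)^-1 * rho ^+ #|S| *
      ((F x * chi S x) * (F y * chi S y)).
  congr (_ * _); apply: eq_bigr => x _; rewrite mulr_sumr.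
  apply: eq_bigr => y _; rewrite trans_fourier mulr_sumr mulr_suml mulr_sumr.
  by apply: eq_bigr => S _; rewrite /F; ring.
have -> : \sum_x \sum_y \sum_(S : {set 'I_n}) (2 ^+ n)^-1 * rho ^+ #|S| *
      ((F x * chi S x) * (F y * chi S y)) =
    \sum_(S : {set 'I_n}) \sum_x \sum_y (2 ^+ n)^-1 * rho ^+ #|S| *
      ((F x * chi S x) * (F y * chi S y)).
  rewrite [RHS]exchange_big; apply: eq_bigr => x _ /=.
  by rewrite exchange_big.
rewrite mulr_sumr; apply: eq_bigr => S _.
rewrite /fourier /Eunif -/F.
under eq_bigr do rewrite -mulr_sumr -mulr_sumr.
rewrite -mulr_sumr -mulr_suml; ring.
Qed.

(** The operator is self-adjoint and its square is the operator of noise [rho ^+ 2]. *)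
Lemma Eunif_Trho_sqr (rho : R) (f : cube n -> bool) :
  Eunif (fun x => Trho rho f x ^+ 2) =
  Eunif (fun x => (f x)%:R * Trho (rho ^+ 2) f x).
Proof.
congr (_ * _).
have -> : \sum_x Trho rho f x ^+ 2 = \sum_x \sum_y \sum_z
    (f y)%:R * (f z)%:R * (trans rho x y * trans rho x z).
  apply: eq_bigr => x _; rewrite expr2 mulr_suml; apply: eq_bigr => y _.
  by rewrite mulr_sumr; apply: eq_bigr => z _; ring.
rewrite exchange_big /=; apply: eq_bigr => y _.
rewrite exchange_big mulr_sumr /=; apply: eq_bigr => z _.
by rewrite -mulr_sumr trans_semigroup; ring.
Qed.

(* In Fourier space, each [S] of size [k >= 1] contributes the inequality
   [rho ^ (2 k) <= rho ^ (k + 1)]. *)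
Lemma Trho_second_moment (rho : R) (f : cube n -> bool) (a : R) :
  0 < rho < 1 -> Eunif (fun x => (f x)%:R) = a ->
  Eunif (fun x => Trho rho f x ^+ 2) <=
  a ^+ 2 + rho * (Eunif (fun x => (f x)%:R * Trho rho f x) - a ^+ 2).
Proof.
move=> /andP[r0 r1] fa; rewrite Eunif_Trho_sqr !Eunif_mul_Trho.
have c0 : fourier (fun x => (f x)%:R) (finset.set0 : {set 'I_n}) = a.
  rewrite -fa /fourier; congr (_ * _); apply: eq_bigr => x _.
  by rewrite /chi big_set0 mulr1.
have split0 (r : R) :
    \sum_(S : {set 'I_n}) r ^+ #|S| * fourier (fun x => (f x)%:R) S ^+ 2 =
    a ^+ 2 + \sum_(S : {set 'I_n} | S != finset.set0)
                r ^+ #|S| * fourier (fun x => (f x)%:R) S ^+ 2.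
  by rewrite (bigD1 (finset.set0 : {set 'I_n})) //= cards0 expr0 mul1r c0.
rewrite !split0 addrAC subrr add0r.
rewrite lerD2l mulr_sumr; apply: ler_sum => S S0.
rewrite mulrA ler_wpM2r ?sqr_ge0// -exprM -exprS.
rewrite ler_wiXn2l ?ltW//.
by rewrite -card_gt0 in S0; rewrite mul2n -addnn -addn1 addnC leq_add2r.
Qed.

End NoiseOperator.

(** Integrality makes [2 ^+ n * a] a cardinal [k]; the indicator of the first [k] enumerated points
    works. *)
Lemma exists_cube_fun (R : realType) (n : nat) (a : R) : 0 < a < 1 ->
  (exists k : int, (2 : R) ^+ n * a = k%:~R) ->
  exists f : cube n -> bool, Eunif (fun x => (f x)%:R) = a.
Proof.
move=> /andP[a0 a1] [k hk].
have p2 : 0 < (2 : R) ^+ n by rewrite exprn_gt0.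
have k0 : (0 <= k)%R by rewrite -(ler0z R) -hk mulr_ge0// ltW.
case: k k0 hk => // k _ hk.
have kle : (k <= size (enum (cube n)))%N.
  rewrite -cardE card_ffun card_bool card_ord -(ler_nat R) natrX.
  have -> : (k%:R : R) = 2 ^+ n * a by rewrite hk.
  by rewrite ler_piMr ?ltW.
pose s := take k (enum (cube n)); exists (fun x => x \in s); rewrite /Eunif.
have ss : size s = k by rewrite size_takel.
have us : uniq s by rewrite take_uniq ?enum_uniq.
have -> : \sum_x (x \in s)%:R = k%:R :> R.
  rewrite -ss -(card_uniqP us) -sum1_card natr_sum [RHS]big_mkcond.
  by apply: eq_bigr => x _; case: (x \in s).
have -> : (k%:R : R) = 2 ^+ n * a by rewrite hk.
by rewrite mulKf ?gt_eqF.
Qed.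

(** * Construction of the dominating parabolas *)

Section DualCertificate.
Variables (R : realType) (Phi g : R -> R).
Hypotheses (Phi_g : primitive01 Phi g) (g_conc : strictly_concave01 g).
Hypothesis g_incr : forall x y, 0 < x -> x < y -> y < 1 -> g x < g y.
Hypothesis g_cont : forall x, 0 < x < 1 -> {for x, continuous g}.

(* The curvature of the parabola that is tangent to the graph of [Phi] at [x]
   and passes through [(0, Phi 0)]. *)
Definition chord_curv (x : R) : R := (x * g x - Phi x + Phi 0) / x ^+ 2.

Lemma chord_curvE (x : R) : 0 < x ->
  Phi 0 = Phi x - g x * x + chord_curv x * x ^+ 2.
Proof.
by move=> x0; rewrite /chord_curv divfK ?sqrf_eq0 ?gt_eqF//; ring.
Qed.

(** The chord from [0] to [x] has slope [g c] for some [c < x], which is below the tangent slope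
    [g x]. *)
Lemma chord_curv_gt0 (x : R) : 0 < x < 1 -> 0 < chord_curv x.
Proof.
move=> /andP[x0 x1]; rewrite /chord_curv divr_gt0 ?exprn_gt0//.
have [c /andP[c0 cx] e] := primitive01_mvt Phi_g (lexx _) x0 (ltW x1).
have gc := g_incr c0 cx x1.
nra.
Qed.

(** The bound grows with [mu], so [mu = chord_curv x1] suffices; then [Phi] minus the parabola takes
    equal values at [0] and [x1] and is critical at [x1]. *)
Lemma tangent_parabola_le (x1 mu x : R) :
  0 < x1 < 1 -> chord_curv x1 <= mu -> 0 <= x <= 1 ->
  Phi x <= Phi x1 + g x1 * (x - x1) + mu * (x - x1) ^+ 2.
Proof.
move=> x101 hmu x01; have /andP[x10 x11] := x101.
apply: (@le_trans _ _
  (Phi x1 + g x1 * (x - x1) + chord_curv x1 * (x - x1) ^+ 2)); last first.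
  by rewrite lerD2l ler_wpM2r// sqr_ge0.
have E := chord_curvE x10; move: E; set m := chord_curv x1 => E.
pose l := g x1 - 2 * m * x1.
have /(_ x1 x x101) := le_max_at_0_and_zero
  (primitive01_addquad l m Phi_g) (strictly_concave01_addlin l m g_conc).
have e0 : Phi 0 - l * 0 - m * 0 ^+ 2 = Phi x1 - l * x1 - m * x1 ^+ 2.
  by rewrite E /l; ring.
have e1 : g x1 - l - 2 * m * x1 = 0 by rewrite /l; ring.
move=> /(_ e0 e1 x01); rewrite /l; nra.
Qed.

(** The equation for [g x2] makes [Phi] minus the parabola critical at [x2], with slope
    [mu * rho > 0] at [x1]; this settles [[x1, 1]]. This parabola minus the one of
    [tangent_parabola_le] has slope [- mu * rho] and is nonnegative at [x1], hence also to the left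
    of [x1]. *)
Lemma upper_parabola_le (rho x1 x2 mu x : R) :
  0 < rho -> 0 < x1 -> x1 < x2 -> x2 < 1 -> 0 < mu -> chord_curv x1 <= mu ->
  g x2 = g x1 + mu * (2 * (x2 - x1) - rho) -> 0 <= x <= 1 ->
  Phi x <= Phi x2 + (g x1 - 2 * mu * x1) * (x - x2)
           + mu * ((x ^+ 2 - rho * x) - (x2 ^+ 2 - rho * x2)).
Proof.
move=> r0 x10 x12 x21 m0 hmu hg x01; have /andP[x0 xle1] := x01.
have x11 := lt_trans x12 x21.
pose l := g x1 - 2 * mu * x1 - mu * rho.
have hk := primitive01_addquad l mu Phi_g.
have kc := strictly_concave01_addlin l mu g_conc.
have k1 : 0 < g x1 - l - 2 * mu * x1.
  have -> : g x1 - l - 2 * mu * x1 = mu * rho by rewrite /l; ring.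
  exact: mulr_gt0.
have k2 : g x2 - l - 2 * mu * x2 = 0 by rewrite hg /l; ring.
have [xx1|x1x] := leP x x1.
  have := le_max_at_upper_zero hk kc x10 x12 x21 k1 k2 (x := x1).
  rewrite lexx (ltW x11) => /(_ isT).
  have x101 : 0 < x1 < 1 by rewrite x10.
  have := tangent_parabola_le x101 hmu x01.
  have : 0 <= mu * rho * (x1 - x) by rewrite !mulr_ge0 ?subr_ge0// ltW.
  rewrite /l; nra.
have := le_max_at_upper_zero hk kc x10 x12 x21 k1 k2 (x := x).
rewrite (ltW x1x) xle1 => /(_ isT).
rewrite /l; nra.
Qed.

Lemma chord_curv_continuous (x : R) :
  0 < x < 1 -> {for x, continuous chord_curv}.
Proof.
move=> x01; have /andP[x0 x1] := x01.
apply: cvgM; last first.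
  apply: cvgV; first by rewrite sqrf_eq0 gt_eqF.
  exact: exprn_continuous.
apply: cvgD; last exact: cvg_cst.
apply: cvgB; first by apply: cvgM; [exact: cvg_id|exact: g_cont].
have [_ /(_ _ x01) Pd] := Phi_g.
by apply: differentiable_continuous; apply/derivable1_diffP.
Qed.

Variables (a rho : R).
Hypotheses (a01 : 0 < a < 1) (rho01 : 0 < rho < 1).

Let X1 z := a + rho * z1_of rho a z.
Let X2 z := a + rho * z.

(* At a zero of [stationarity] the parabola of curvature [chord_curv] is
   simultaneously tangent for both values of the conditioning bit. *)
Definition stationarity (z : R) : R :=
  g (X1 z) + chord_curv (X1 z) * (2 * (X2 z - X1 z) - rho) - g (X2 z).

Lemma stationarity_continuous :
  {within `[0, 1 - a], continuous stationarity}.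
Proof.
apply: continuous_in_subspaceT => z; rewrite inE/= in_itv/= => /andP[z0 z1].
have X1z : 0 < X1 z < 1.
  by rewrite (x1_gt0 a01 rho01 z0 z1) (x1_lt1 a01 rho01 z0 z1).
have X2z : 0 < X2 z < 1.
  have /andP[/lt_le_trans X1p _] := X1z.
  by rewrite (X1p _ (x1_le_x2 a01 rho01 z0 z1)) (x2_lt1 a01 rho01 z1).
have X2c : {for z, continuous X2}.
  apply: cvgD; first exact: cvg_cst.
  by apply: cvgM; [exact: cvg_cst|exact: cvg_id].
have X1c : {for z, continuous X1}.
  apply: cvgD; first exact: cvg_cst.
  apply: cvgM; first exact: cvg_cst.
  apply: cvgM.
    apply: cvgM; first exact: cvg_id.
    apply: cvgB; last exact: cvg_cst.
    apply: cvgM; first exact: cvg_cst.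
    by apply: cvgB; [exact: cvg_cst|exact: cvg_id].
  apply: cvgV.
    rewrite gt_eqF//; move: X2z => /andP[_]; rewrite /X2; lra.
  apply: cvgB; first exact: cvg_cst.
  by apply: cvgM; [exact: cvg_cst|exact: cvg_id].
apply: cvgB; last exact: (continuous_comp X2c (g_cont X2z)).
apply: cvgD; first exact: (continuous_comp X1c (g_cont X1z)).
apply: cvgM.
  exact: (continuous_comp X1c (chord_curv_continuous X1z)).
apply: cvgB; last exact: cvg_cst.
apply: cvgM; first exact: cvg_cst.
exact: cvgB.
Qed.

(* Either the stationarity condition has a zero, or it is still negative at
   the end point [1 - a]; there the atom at [0] has mass zero, so that the
   parabola need not touch the graph at [0] and its curvature is free. *)
Lemma stationary_point : exists z mu : R,
  [/\ 0 < z <= 1 - a, 0 < mu, chord_curv (X1 z) <= mu,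
      g (X2 z) = g (X1 z) + mu * (2 * (X2 z - X1 z) - rho)
    & z = 1 - a \/ mu = chord_curv (X1 z)].
Proof.
have /andP[a0 a1] := a01; have /andP[r0 r1] := rho01.
have X0 : X1 0 = a by exact: x1_at_0.
have Xm : X1 (1 - a) = X2 (1 - a) - rho by exact: x1_at_max.
have z1 : 0 < 1 - a by rewrite subr_gt0.
(* Both atoms equal [a] at [z = 0], leaving [- rho * chord_curv a]. *)
have S0 : stationarity 0 < 0.
  rewrite /stationarity X0 /X2 mulr0 addr0.
  by have := mulr_gt0 (chord_curv_gt0 a01) r0; lra.
have c01 : 0 < X1 (1 - a) < 1.
  rewrite (x1_gt0 a01 rho01 (ltW z1) (lexx _)).
  by rewrite (x1_lt1 a01 rho01 (ltW z1) (lexx _)).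
have [Sm|Sm] := ltP (stationarity (1 - a)) 0.
  (* The atoms are [rho] apart, so tangency at [X2] reads [g x2 - g x1 = mu * rho]; the sign of
     [stationarity] then gives [chord_curv <= mu]. *)
  pose mu := (g (X2 (1 - a)) - g (X1 (1 - a))) / rho.
  have cmu : chord_curv (X1 (1 - a)) <= mu.
    rewrite ler_pdivlMr//; move: Sm; rewrite /stationarity Xm; nra.
  exists (1 - a), mu; split => //.
  - by rewrite z1 lexx.
  - exact: lt_le_trans (chord_curv_gt0 c01) cmu.
  - have -> : 2 * (X2 (1 - a) - X1 (1 - a)) - rho = rho by rewrite Xm; ring.
    by rewrite divfK ?gt_eqF//; ring.
  - by left.
have [||z] := @IVT R stationarity 0 (1 - a) 0 (ltW z1).
- exact: stationarity_continuous.
- by rewrite ge_min (ltW S0)/= le_max Sm orbT.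
rewrite in_itv/= => /andP[z0 zle] Sz.
have {}z0 : 0 < z.
  by rewrite lt_def z0 andbT; apply/eqP => ze; rewrite ze in Sz; rewrite Sz ltxx in S0.
exists z, (chord_curv (X1 z)); split => //.
- by rewrite z0.
- apply: chord_curv_gt0.
  by rewrite (x1_gt0 a01 rho01 (ltW z0) zle) (x1_lt1 a01 rho01 (ltW z0) zle).
- by move: Sz; rewrite /stationarity; lra.
- by right.
Qed.

Definition Gamma_val (z2 : R) : R :=
  (1 - a - p_of rho a z2) * Phi 0
  + p_of rho a z2 * Phi (a + rho * z1_of rho a z2)
  + a * Phi (a + rho * z2).

(** The final equation is complementary slackness: the parabolas touch [Phi] at each atom of
    positive mass, so integrating them against the law of [z2] gives its objective value. *)
Lemma dual_certificate : exists z2 al0 al1 la mu : R,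
  [/\ 0 <= z2 <= 1 - a, 0 <= mu,
      forall x, 0 <= x <= 1 -> Phi x <= al0 + la * x + mu * x ^+ 2,
      forall x, 0 <= x <= 1 -> Phi x <= al1 + la * x + mu * (x ^+ 2 - rho * x)
    & (1 - a) * al0 + a * al1 + la * a + mu * (a ^+ 2 * (1 - rho))
      = Gamma_val z2].
Proof.
have /andP[a0 a1] := a01; have /andP[r0 r1] := rho01.
have [z [mu [/andP[z0 zle] mu0 cmu ge ztop]]] := stationary_point.
have x1p : 0 < X1 z := x1_gt0 a01 rho01 (ltW z0) zle.
have x11 : X1 z < 1 := x1_lt1 a01 rho01 (ltW z0) zle.
have x2l : X2 z < 1 := x2_lt1 a01 rho01 zle.
have mean := three_point_mean a01 rho01 (ltW z0) zle.
have mom2 := three_point_second_moment a01 rho01 (ltW z0) zle.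
have x101 : 0 < X1 z < 1 by rewrite x1p.
(* Coinciding atoms would turn the tangency equation into [mu * rho = 0]. *)
have x12 : X1 z < X2 z.
  rewrite lt_neqAle (x1_le_x2 a01 rho01 (ltW z0) zle) andbT.
  apply/eqP => e; move: ge; rewrite e.
  by have := mulr_gt0 mu0 r0; lra.
pose la := g (X1 z) - 2 * mu * X1 z.
pose al0 := Phi (X1 z) - la * X1 z - mu * X1 z ^+ 2.
pose al1 := Phi (X2 z) - la * X2 z - mu * (X2 z ^+ 2 - rho * X2 z).
exists z, al0, al1, la, mu; split.
- by rewrite (ltW z0).
- exact: ltW.
- move=> x x01; have := tangent_parabola_le x101 cmu x01.
  by rewrite /al0 /la; lra.
- move=> x x01; have := upper_parabola_le r0 x1p x12 x2l mu0 cmu ge x01.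
  by rewrite /al1 /la; lra.
(* Either the atom at [0] has no mass, or the parabola passes through [(0, Phi 0)]. *)
have mass0 : (1 - a - p_of rho a z) * Phi 0 = (1 - a - p_of rho a z) * al0.
  case: ztop => [->|mue]; first by rewrite p_of_at_max// subrr !mul0r.
  by rewrite (chord_curvE x1p) -mue /al0 /la; congr (_ * _); ring.
rewrite /Gamma_val mass0 -/(X1 z) -/(X2 z) -[in la * a]mean -mom2 -/(X1 z).
by rewrite -/(X2 z) /al0 /al1; ring.
Qed.

End DualCertificate.

(** * Weak duality for feasible laws and for Boolean functions *)

Definition Lambda_set (R : realType) (Phi : R -> R) (rho a : R) (m : nat) :=
  [set v | exists (z p : bool -> 'I_m -> R),
    [/\ (forall b i, 0 < p b i),
        (forall b i, 0 <= a + rho * z b i <= 1),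
        (forall b, \sum_(i < m) p b i = PS a b),
        (\sum_(b : bool) \sum_(i < m) p b i * z b i = 0) /\
        (\sum_(b : bool) \sum_(i < m)
            p b i * (z b i ^+ 2 - Defs.sval a b * z b i) <= 0)
      & v = \sum_(b : bool) \sum_(i < m) p b i * Phi (a + rho * z b i)]].

Section WeakDuality.
Variables (R : realType) (Phi : R -> R) (a rho al0 al1 la mu : R).
Hypotheses (rho01 : 0 < rho < 1) (mu_ge0 : 0 <= mu).
Hypothesis cert0 : forall x, 0 <= x <= 1 ->
  Phi x <= al0 + la * x + mu * x ^+ 2.
Hypothesis cert1 : forall x, 0 <= x <= 1 ->
  Phi x <= al1 + la * x + mu * (x ^+ 2 - rho * x).

Lemma Lambda_set_le (m : nat) (v : R) : Lambda_set Phi rho a m v ->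
  v <= (1 - a) * al0 + a * al1 + la * a + mu * (a ^+ 2 * (1 - rho)).
Proof.
move=> [z [p [p0 zb ps [m1 m2] ->]]].
(* Coefficients of the parabola for bit [b] at [x = a + rho z] in the basis [1], [z], [z^2 - s z].
   Only [k] depends on [b], so the three constraints evaluate or bound the sum. *)
pose k b := (if b then al1 - mu * rho * a else al0) + la * a + mu * a ^+ 2.
pose c1 := la * rho + 2 * a * rho * mu - a * rho ^+ 2 * mu.
pose c2 := rho ^+ 2 * mu.
have step b i : p b i * Phi (a + rho * z b i) <= k b * p b i +
    c1 * (p b i * z b i) + c2 * (p b i * (z b i ^+ 2 - Defs.sval a b * z b i)).
  have -> : k b * p b i + c1 * (p b i * z b i)
      + c2 * (p b i * (z b i ^+ 2 - Defs.sval a b * z b i))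
    = p b i * (k b + c1 * z b i + c2 * (z b i ^+ 2 - Defs.sval a b * z b i)) by ring.
  rewrite ler_pM2l//; case: b => /=.
    by have := cert1 (zb true i); rewrite /k /c1 /c2 /Defs.sval; nra.
  by have := cert0 (zb false i); rewrite /k /c1 /c2 /Defs.sval; nra.
apply: (@le_trans _ _ (\sum_(b : bool) \sum_(i < m) (k b * p b i +
    c1 * (p b i * z b i) + c2 * (p b i * (z b i ^+ 2 - Defs.sval a b * z b i))))).
  by apply: ler_sum => b _; apply: ler_sum.
under eq_bigr do rewrite !big_split /= -!mulr_sumr ps.
rewrite !big_split /= -!mulr_sumr m1 mulr0 addr0 big_bool /=.
have : c2 * (\sum_(b : bool) \sum_(i < m)
    p b i * (z b i ^+ 2 - Defs.sval a b * z b i)) <= 0.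
  by rewrite mulr_ge0_le0// mulr_ge0 ?sqr_ge0.
by rewrite /k /PS; lra.
Qed.

Lemma Eunif_Phi_Trho_le (n : nat) (f : cube n -> bool) :
  Eunif (fun x => (f x)%:R) = a ->
  Eunif (fun x => Phi (Trho rho f x)) <=
    (1 - a) * al0 + a * al1 + la * a + mu * (a ^+ 2 * (1 - rho)).
Proof.
move=> fa; have m2 := Trho_second_moment rho01 fa.
have m1 : Eunif (Trho rho f) = a by rewrite Eunif_Trho.
pose T := Trho rho f.
have N0 : 0 <= ((2 : R) ^+ n)^-1 by rewrite invr_ge0 exprn_ge0.
have one : Eunif (fun _ : cube n => 1 : R) = 1.
  rewrite /Eunif sumr_const card_ffun card_bool card_ord.
  by rewrite natrX mulVf// expf_neq0// pnatr_eq0.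
(* As [f x] is [0] or [1], one polynomial in [f x] and [T x] encodes both parabolas. *)
apply: (@le_trans _ _ (Eunif (fun x : cube n => al0 * 1 +
    (al1 - al0) * (f x)%:R + la * T x + mu * T x ^+ 2
    - mu * rho * ((f x)%:R * T x)))).
  rewrite /Eunif ler_wpM2l//; apply: ler_sum => x _.
  have T01 := Trho_itv f x rho01.
  case: (f x); first by have := cert1 T01; rewrite /T/=; nra.
  by have := cert0 T01; rewrite /T/=; nra.
have -> : Eunif (fun x : cube n => al0 * 1 +
    (al1 - al0) * (f x)%:R + la * T x + mu * T x ^+ 2
    - mu * rho * ((f x)%:R * T x)) =
  al0 * Eunif (fun _ : cube n => 1) + (al1 - al0) * Eunif (fun x => (f x)%:R)
  + la * Eunif T + mu * Eunif (fun x => T x ^+ 2)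
  - mu * rho * Eunif (fun x => (f x)%:R * T x).
  by rewrite /Eunif sumrB !big_split /= -!mulr_sumr; ring.
rewrite one fa m1.
have := ler_wpM2l mu_ge0 m2; rewrite -/T; nra.
Qed.

End WeakDuality.

(** * Feasibility of the three-point laws *)

Lemma Lambda_set_three_atoms (R : realType) (Phi : R -> R) (rho a : R)
    (k : nat) (q0 q1 z0 z1 z2 : R) :
  0 < a -> 0 < q0 -> 0 < q1 -> q0 + q1 = 1 - a ->
  0 <= a + rho * z0 <= 1 -> 0 <= a + rho * z1 <= 1 ->
  0 <= a + rho * z2 <= 1 ->
  q0 * z0 + q1 * z1 + a * z2 = 0 ->
  q0 * (z0 ^+ 2 + a * z0) + q1 * (z1 ^+ 2 + a * z1)
    + a * (z2 ^+ 2 - (1 - a) * z2) <= 0 ->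
  Lambda_set Phi rho a k.+2 (q0 * Phi (a + rho * z0)
    + q1 * Phi (a + rho * z1) + a * Phi (a + rho * z2)).
Proof.
move=> a0 q00 q10 q01 b0 b1 b2 m1 m2.
pose z (b : bool) (i : 'I_k.+2) :=
  if b then z2 else if i == ord0 then z0 else z1.
pose p (b : bool) (i : 'I_k.+2) : R :=
  if b then a / k.+2%:R else if i == ord0 then q0 else q1 / k.+1%:R.
have sumt (F : R -> R) : \sum_(i < k.+2) p true i * F (z true i) = a * F z2.
  rewrite /p /z /= sumr_const card_ord -[LHS]mulr_natl mulrA; congr (_ * _).
  by rewrite mulrC divfK ?pnatr_eq0.
have sumf (F : R -> R) :
    \sum_(i < k.+2) p false i * F (z false i) = q0 * F z0 + q1 * F z1.
  rewrite big_ord_recl /p /z /=; congr (_ + _).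
  rewrite sumr_const card_ord -[LHS]mulr_natl mulrA; congr (_ * _).
  by rewrite mulrC divfK ?pnatr_eq0.
exists z, p; split.
- by move=> [|] i; rewrite /p; [|case: ifP => _ //]; rewrite divr_gt0.
- by move=> [|] i; rewrite /z //; case: ifP.
- move=> [|]; rewrite /PS.
    have := sumt (fun=> 1); rewrite mulr1 => <-.
    by apply: eq_bigr => i _; rewrite mulr1.
  have := sumf (fun=> 1); rewrite !mulr1 q01 => <-.
  by apply: eq_bigr => i _; rewrite mulr1.
- split.
    by rewrite big_bool /= (sumt id) (sumf id) addrC.
  rewrite big_bool /= (sumt (fun y => y ^+ 2 - Defs.sval a true * y)).
  rewrite (sumf (fun y => y ^+ 2 - Defs.sval a false * y)) /Defs.sval !mulNr !opprK.
  by rewrite addrC.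
- rewrite big_bool /= (sumt (fun y => Phi (a + rho * y))).
  by rewrite (sumf (fun y => Phi (a + rho * y))) addrC.
Qed.

Lemma Gamma_val_in_Lambda_set (R : realType) (Phi : R -> R) (rho a z2 : R)
    (m : nat) :
  0 < a < 1 -> 0 < rho < 1 -> 0 <= z2 <= 1 - a -> (2 <= m)%N ->
  Lambda_set Phi rho a m (Gamma_val Phi a rho z2).
Proof.
move=> a01 rho01 /andP[z20 z2le]; case: m => [|[|k]]// _.
have /andP[a0 a1] := a01; have /andP[r0 r1] := rho01.
have r_neq0 : rho != 0 by rewrite gt_eqF.
have mean := three_point_mean a01 rho01 z20 z2le.
have mom2 := three_point_second_moment a01 rho01 z20 z2le.
have p0 := p_of_gt0 a01 rho01 z20 z2le.
have ple := p_of_le a01 rho01 z20 z2le.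
have b1 : 0 <= a + rho * z1_of rho a z2 <= 1.
  rewrite (ltW (x1_gt0 a01 rho01 z20 z2le)).
  by rewrite (ltW (x1_lt1 a01 rho01 z20 z2le)).
have b2 : 0 <= a + rho * z2 <= 1.
  by rewrite (ltW (x2_lt1 a01 rho01 z2le)) addr_ge0 ?mulr_ge0// ltW.
rewrite /Gamma_val.
move: mean mom2 p0 ple b1 b2; set p := p_of rho a z2; set z1 := z1_of rho a z2.
move=> mean mom2 p0 ple b1 b2.
(* With no mass at [0], the atom [z1] is split into halves to fill both slots. *)
have [pe|pn] := eqVneq p (1 - a).
  rewrite pe in mean mom2 *.
  have -> : (1 - a - (1 - a)) * Phi 0 + (1 - a) * Phi (a + rho * z1)
      + a * Phi (a + rho * z2) =
    (1 - a) / 2 * Phi (a + rho * z1) + (1 - a) / 2 * Phi (a + rho * z1)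
      + a * Phi (a + rho * z2) by field.
  have M1 : (1 - a) * z1 + a * z2 = 0.
    by apply: (mulfI r_neq0); rewrite mulr0; nra.
  apply: Lambda_set_three_atoms => //; try lra.
  (* Up to the factor [rho ^+ 2], this is the second moment identity plus [rho * a - 2 * a] times
     the mean identity: the constraint is tight. *)
  have : rho ^+ 2 * ((1 - a) * (z1 ^+ 2 + a * z1)
      + a * (z2 ^+ 2 - (1 - a) * z2)) = 0.
    move/eqP: mean; rewrite -subr_eq0 => /eqP mean.
    move/eqP: mom2; rewrite -subr_eq0 => /eqP mom2.
    rewrite -[RHS](addr0 0) -{1}mom2 -(mulr0 (rho * a - 2 * a)) -mean; ring.
  move=> /eqP; rewrite mulf_eq0 sqrf_eq0 (negbTE r_neq0) /= => /eqP; lra.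
have plt : p < 1 - a by rewrite lt_neqAle pn.
(* The atom at [x = 0] is [z = - a / rho]. *)
have e0 : a + rho * (- a / rho) = 0 by field.
rewrite -[in Phi 0]e0.
have M1 : (1 - a - p) * (- a / rho) + p * z1 + a * z2 = 0.
  apply: (mulfI r_neq0); rewrite mulr0.
  have -> : rho * ((1 - a - p) * (- a / rho) + p * z1 + a * z2) =
    - a * (1 - a - p) + rho * (p * z1 + a * z2) by field.
  nra.
apply: Lambda_set_three_atoms => //; try lra.
have : rho ^+ 2 * ((1 - a - p) * ((- a / rho) ^+ 2 + a * (- a / rho))
    + p * (z1 ^+ 2 + a * z1) + a * (z2 ^+ 2 - (1 - a) * z2)) = 0.
  have -> : rho ^+ 2 * ((1 - a - p) * ((- a / rho) ^+ 2 + a * (- a / rho))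
    + p * (z1 ^+ 2 + a * z1) + a * (z2 ^+ 2 - (1 - a) * z2)) =
    (1 - a - p) * (a ^+ 2 - a ^+ 2 * rho) + rho ^+ 2 *
    (p * (z1 ^+ 2 + a * z1) + a * (z2 ^+ 2 - (1 - a) * z2)) by field.
  move/eqP: mean; rewrite -subr_eq0 => /eqP mean.
  move/eqP: mom2; rewrite -subr_eq0 => /eqP mom2.
  rewrite -[RHS](addr0 0) -{1}mom2 -(mulr0 (rho * a - 2 * a)) -mean; ring.
by move=> /eqP; rewrite mulf_eq0 sqrf_eq0 (negbTE r_neq0) /= => /eqP ->.
Qed.

(** * Regularity of the derivative, and the conclusion *)

Lemma strictly_concave01_from_jensen (R : realType) (g : R -> R) :
  (forall x y t : R, 0 < x < 1 -> 0 < y < 1 -> x != y -> 0 < t < 1 ->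
     t * g x + (1 - t) * g y < g (t * x + (1 - t) * y)) ->
  strictly_concave01 g.
Proof.
move=> J x y z x0 xy yz z1.
have xz := lt_trans xy yz.
have xz0 : 0 < z - x by rewrite subr_gt0.
have zx_neq0 : z - x != 0 by rewrite gt_eqF.
have t01 : 0 < (z - y) / (z - x) < 1.
  by rewrite divr_gt0 ?subr_gt0// ltr_pdivrMr// mul1r ltrD2l ltrN2 xy.
have x01 : 0 < x < 1 by rewrite x0 (lt_trans xz).
have z01 : 0 < z < 1 by rewrite z1 (lt_trans x0).
have := J x z _ x01 z01 (negbT (lt_eqF xz)) t01.
have -> : (z - y) / (z - x) * x + (1 - (z - y) / (z - x)) * z = y by field.
rewrite -(ltr_pM2l xz0).
suff -> : (z - x) * ((z - y) / (z - x) * g x + (1 - (z - y) / (z - x)) * g z) =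
  (z - y) * g x + (y - x) * g z by [].
by field.
Qed.

(** The value at the midpoint exceeds the average of [g x] and [g y] by concavity and is at most
    [g y] by monotonicity. *)
Lemma strictly_concave01_incr (R : realType) (g : R -> R) :
  strictly_concave01 g ->
  (forall x y : R, 0 < x < 1 -> 0 < y < 1 -> x <= y -> g x <= g y) ->
  forall x y : R, 0 < x -> x < y -> y < 1 -> g x < g y.
Proof.
move=> gc gi x y x0 xy y1.
have xm : x < (x + y) / 2 by lra.
have my : (x + y) / 2 < y by lra.
have := gc _ _ _ x0 xm my y1.
have m01 : 0 < (x + y) / 2 < 1 by lra.
have y01 : 0 < y < 1 by lra.
have := gi _ _ m01 y01 (ltW my).
have d : 0 < (y - x) / 2 by lra.
set gm := g ((x + y) / 2) => h1 h2.
have : (y - x) / 2 * (g x + g y) < (y - x) / 2 * (2 * gm) by lra.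
rewrite ltr_pM2l//; lra.
Qed.

Unset Implicit Arguments.

Theorem theorem2p6 (R : realType) (Phi : R -> R) (n : nat) (a rho : R) :
  {within [set x : R | 0 <= x <= 1], continuous Phi} ->
  (forall x : R, 0 < x < 1 -> derivable Phi x 1) ->
  (forall x y : R, 0 < x < 1 -> 0 < y < 1 -> x <= y -> (derive1 Phi) x <= (derive1 Phi) y) ->
  (forall x : R, 0 < x < 1 -> {for x, continuous (derive1 Phi)}) ->
  (forall x y t : R, 0 < x < 1 -> 0 < y < 1 -> x != y -> 0 < t < 1 ->
     t * (derive1 Phi) x + (1 - t) * (derive1 Phi) y < (derive1 Phi) (t * x + (1 - t) * y)) ->
  (1 <= n)%N -> 0 < a < 1 -> 0 < rho < 1 ->
  (exists k : int, (2 : R) ^+ n * a = k%:~R) ->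
  forall m : nat, (3 <= m)%N ->
    MaxStab Phi rho n a <= LambdaM Phi rho a m /\
    LambdaM Phi rho a m = GammaT Phi rho a.
Proof.
move=> Phi_cont Phi_der g_ndecr g_cont g_jensen _ a01 rho01 ka m m3.
have g_conc := strictly_concave01_from_jensen g_jensen.
have g_incr := strictly_concave01_incr g_conc g_ndecr.
have Phi_g : primitive01 Phi (derive1 Phi).
  by split=> // x /Phi_der Pd; rewrite derive1E; exact: derivableP.
have [z2 [al0 [al1 [la [mu [z2b mu0 c0 c1 E]]]]]] :=
  dual_certificate Phi_g g_conc g_incr g_cont a01 rho01.
(* The certificate value bounds the whole feasible set and is attained in it at [z2]; the
   one-parameter family lies in that set, so both suprema equal it. *)
have Lub : ubound (Lambda_set Phi rho a m) (Gamma_val Phi a rho z2).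
  by move=> v /(Lambda_set_le mu0 c0 c1); rewrite E.
have inL z : 0 <= z <= 1 - a -> Lambda_set Phi rho a m (Gamma_val Phi a rho z).
  by move=> zb; apply: Gamma_val_in_Lambda_set => //; exact: ltnW.
have supL : LambdaM Phi rho a m = Gamma_val Phi a rho z2.
  apply/eqP; rewrite eq_le; apply/andP; split.
    by apply: ge_sup => //; exists (Gamma_val Phi a rho z2); exact: inL.
  by apply: ub_le_sup; [exists (Gamma_val Phi a rho z2)|exact: inL].
have Gub : ubound [set v | exists z2 : R, 0 <= z2 <= 1 - a /\
    v = Gamma_val Phi a rho z2] (Gamma_val Phi a rho z2).
  by move=> _ [z [zb ->]]; exact/Lub/inL.
have supG : GammaT Phi rho a = Gamma_val Phi a rho z2.
  apply/eqP; rewrite eq_le; apply/andP; split.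
    by apply: ge_sup => //; exists (Gamma_val Phi a rho z2), z2.
  by apply: ub_le_sup; [exists (Gamma_val Phi a rho z2)|exists z2].
split; last by rewrite supL supG.
rewrite supL; apply: ge_sup.
  (* The [sup] of an empty set is [0] by default, so some [f] of mean [a] must be exhibited. *)
  have [f fa] := exists_cube_fun a01 ka.
  by exists (Eunif (fun x => Phi (Trho rho f x))), f.
by move=> _ [f [fa ->]]; rewrite -E; exact: (Eunif_Phi_Trho_le rho01 mu0 c0 c1).
Qed.
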